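(* Let $B(r)=\{x\in\{0,1\}^n: |x|\le r\}$ be the Hamming ball of radius $r$ in $\{0,1\}^n$. Then $$\lambda_{B(r)}\ge 2\sqrt{r(n-r)}-o(n).$$ That is, there is a function $\varepsilon:\mathbb{N}\to[0,\infty)$ with $\varepsilon(n)\to 0$ as $n\to\infty$ such that for all $n\ge 1$ and all integers $0\le r\le n$, $\lambda_{B(r)}\ge 2\sqrt{r(n-r)}-\varepsilon(n)\,n$.
   Context: $|x|$ denotes Hamming weight. Two elements $x,y\in\{0,1\}^n$ are adjacent if their Hamming distance is $1$; let $A$ be the adjacency matrix of the resulting graph on $\{0,1\}^n$, acting on functions by $(Af)(x)=\sum_{y\sim x}f(y)$. For nonempty $B\subseteq\{0,1\}^n$, define $$\lambda_B=\max\left\{\frac{\langle Af,f\rangle}{\langle f,f\rangle} : f:\{0,1\}^n\to\mathbb{R},\ f\neq 0,\ \mathrm{supp}(f)\subseteq B\right\},$$ where $\langle f,g\rangle = 2^{-n}\sum_x f(x)g(x)$; that is, $\lambda_B$ is the maximal eigenvalue of the adjacency matrix of the subgraph of the Hamming cube induced by $B$. *)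

(* Defs.v *)
From mathcomp Require Import all_boot all_order all_algebra.
From mathcomp Require Import all_classical all_reals all_analysis.

Set Implicit Arguments.
Unset Strict Implicit.
Unset Printing Implicit Defensive.

Import Order.TTheory GRing.Theory Num.Theory.
Import numFieldNormedType.Exports.
Local Open Scope ring_scope.

Notation cube n := (n.-tuple bool).

Definition hamming_weight n (x : cube n) : nat := #|[set i | tnth x i]|.

Definition hamming_distance n (x y : cube n) : nat :=
  #|[set i | tnth x i != tnth y i]|.

Definition adjacent n : rel (cube n) := fun x y => hamming_distance x y == 1%N.

Definition hamming_ball n (r : nat) : {set cube n} :=
  [set x | (hamming_weight x <= r)%N].

Section Spectral.
Context (R : realType) (n : nat).
Implicit Types (f g : {ffun cube n -> R}) (B : {set cube n}).

Definition adj f : {ffun cube n -> R} :=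
  [ffun x => \sum_(y | adjacent x y) f y].

Definition inner f g : R := 2 ^- n * \sum_x f x * g x.

Definition rayleigh f : R := inner (adj f) f / inner f f.

Definition rayleigh_values B : set R :=
  [set rayleigh f | f in
    [set f : {ffun cube n -> R} | f != 0 /\ support f \subset B]]%classic.

(* For nonempty B the supremum is attained, see lambda_is_max. *)
Definition lambda B : R := sup (rayleigh_values B).

Let norm2 f : R := \sum_x f x * f x.

Let norm2_gt0 f : f != 0 -> 0 < norm2 f.
Proof.
move=> f0; rewrite lt_neqAle sumr_ge0 ?andbT; last first.
  by move=> x _; rewrite -expr2 sqr_ge0.
apply: contra f0 => /eqP/esym/eqP.
rewrite psumr_eq0 => [/allP f0|x _]; last by rewrite -expr2 sqr_ge0.
apply/eqP/ffunP => x; rewrite ffunE.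
by have /f0 := mem_index_enum x; rewrite /= mulf_eq0 orbb => /eqP.
Qed.

Let rayleighZ c f : c != 0 -> rayleigh (c *: f) = rayleigh f.
Proof.
move=> c0.
have E g h : inner (c *: g) (c *: h) = c ^+ 2 * inner g h.
  rewrite /inner mulrCA; congr (_ * _); rewrite mulr_sumr.
  by apply: eq_bigr => x _; rewrite !ffunE mulrACA expr2.
have adjZ : adj (c *: f) = c *: adj f.
  apply/ffunP => x; rewrite !ffunE /GRing.scale /= mulr_sumr.
  by apply: eq_bigr => y _; rewrite ffunE.
by rewrite /rayleigh adjZ !E -mulf_div divff ?mul1r // expf_neq0.
Qed.

Let sum_continuous (T : topologicalType) (I : finType) (P : pred I)
    (h : I -> T -> R) :
  (forall i, continuous (h i)) -> continuous (fun t => \sum_(i | P i) h i t).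
Proof.
by move=> hc; apply: continuous_big => [|i _]; [exact: add_continuous|exact: hc].
Qed.

Theorem lambda_is_max B : B != finset.set0 ->
  rayleigh_values B (lambda B) /\ ubound (rayleigh_values B) (lambda B).
Proof.
move=> /set0Pn[x0 x0B].
pose N := #|{: cube n}|.
pose F (v : 'rV[R]_N) : {ffun cube n -> R} := [ffun x => v ord0 (enum_rank x)].
pose A (i : 'I_N) : set R :=
  if enum_val i \in B then `[(-1 : R), 1]%classic else [set (0 : R)]%classic.
have Fc x : continuous (fun v => F v x).
  move=> v; rewrite /F.
  under [X in continuous_at _ X]funext do rewrite ffunE.
  exact: coord_continuous.
have AFc x : continuous (fun v => adj (F v) x).
  rewrite (_ : (fun v => _) = fun v => \sum_(y | adjacent x y) F v y).
    exact: sum_continuous.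
  by apply: funext => v; rewrite ffunE.
have norm2c : continuous (fun v => norm2 (F v)).
  by apply: sum_continuous => x v; apply: continuousM; exact: Fc.
pose K := ([set v : 'rV[R]_N | forall i, A i (v ord0 i)] `&`
           [set v | norm2 (F v) = 1])%classic.
have cK : compact K.
  apply: compact_closedI.
    apply: rV_compact => i; rewrite /A; case: ifP => _.
      exact: segment_compact.
    exact: compact_set1.
  apply: (@preimage_closed _ _ (fun v => norm2 (F v)) [set 1]%classic).
    by move=> v _; exact: norm2c.
  exact: closed_eq.
pose q v := inner (adj (F v)) (F v).
have qc : continuous q.
  have sc : continuous (fun v => \sum_x adj (F v) x * F v x).
    apply: sum_continuous => x v.
    by apply: continuousM; [exact: AFc|exact: Fc].
  by move=> v; exact: (continuousM (@cst_continuous _ _ (2 ^- n : R) v) (sc v)).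
have K_of f : f != 0 -> support f \subset B ->
    exists2 v, K v & rayleigh (F v) = rayleigh f.
  move=> f0 fB; have f2 := norm2_gt0 f0.
  pose c := (Num.sqrt (norm2 f))^-1.
  have c0 : c != 0 by rewrite invr_eq0 gt_eqF // sqrtr_gt0.
  pose v : 'rV[R]_N := \row_i (c * f (enum_val i)).
  have Fv : F v = c *: f.
    by apply/ffunP => x; rewrite !ffunE mxE enum_rankK.
  have v1 : norm2 (F v) = 1.
    transitivity (c ^+ 2 * norm2 f).
      rewrite Fv /norm2 mulr_sumr; apply: eq_bigr => x _.
      by rewrite !ffunE mulrACA expr2.
    by rewrite exprVn sqr_sqrtr ?ltW // mulVf // gt_eqF.
  exists v; last by rewrite Fv rayleighZ.
  split => // i; rewrite /A mxE; case: ifPn => iB.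
    have -> : c * f (enum_val i) = F v (enum_val i) by rewrite Fv ffunE.
    rewrite /= in_itv /= -ler_norml -(@expr_le1 _ 2) // -normrX ger0_norm ?sqr_ge0 //.
    rewrite -v1 /norm2 (bigD1 (enum_val i)) //= expr2 lerDl sumr_ge0 // => x _.
    by rewrite -expr2 sqr_ge0.
  have /eqP -> : f (enum_val i) == 0.
    by apply: contraNT iB => fi; apply: (fintype.subsetP fB).
  by rewrite mulr0.
have rayK v : K v -> rayleigh (F v) = 2 ^+ n * q v.
  move=> [_ /= v1]; rewrite /rayleigh /q /inner -/(norm2 (F v)) v1 mulr1.
  by rewrite invrK mulrC.
have KB v : K v -> F v != 0 /\ support (F v) \subset B.
  move=> [/= vA v1]; split.
    apply: contra_eq_neq v1 => ->; rewrite /norm2 big1 ?(eq_sym 0) ?oner_eq0 //.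
    by move=> x _; rewrite ffunE mulr0.
  apply/fintype.subsetP => x; rewrite inE ffunE; apply: contraNT => xB.
  by have := vA (enum_rank x); rewrite /A enum_rankK (negbTE xB) => /= ->.
have [v0 Kv0] : (K !=set0)%classic.
  pose f : {ffun cube n -> R} := [ffun x => (x == x0)%:R].
  have f0 : f != 0.
    by apply/eqP => /ffunP/(_ x0)/eqP; rewrite !ffunE eqxx oner_eq0.
  have fB : support f \subset B.
    apply/fintype.subsetP => x; rewrite inE ffunE.
    by case: (eqVneq x x0) => [->|]; rewrite ?eqxx.
  by have [v Kv _] := K_of f f0 fB; exists v.
have [v Kv vmax] : exists2 v, v \in K & forall t, t \in K -> q t <= q v.
  apply: compact_EVT_max => //; first by exists v0.
  exact: continuous_subspaceT.
rewrite inE in Kv.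
have ub : ubound (rayleigh_values B) (rayleigh (F v)).
  move=> _ [f [f0 fB] <-].
  have [t Kt <-] := K_of f f0 fB.
  by rewrite !rayK // ler_wpM2l ?exprn_ge0 // vmax ?inE.
have vB : rayleigh_values B (rayleigh (F v)) by exists (F v) => //; exact: KB.
suff -> : lambda B = rayleigh (F v) by split.
apply/eqP; rewrite eq_le; apply/andP; split.
  by apply: ge_sup => //; exists (rayleigh (F v)).
by apply: ub_le_sup => //; exists (rayleigh (F v)).
Qed.

End Spectral.

(* Main.v *)
(* Test the Rayleigh quotient on f(x) = C(n,|x|)^(-1/2) supported on the m+2
   outermost spheres r-m-1 <= |x| <= r of the ball. Every sphere then carries
   mass 1, and at an interior point with |x| = k one has
     (A f)(x) = (sqrt((n-k)(k+1)) + sqrt(k(n-k+1))) f(x)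
             >= 2 sqrt((n-r)(r-m)) f(x),
   so lambda >= m/(m+2) * 2 sqrt((n-r)(r-m)). Taking m about sqrt(n), this is
   2 sqrt(r(n-r)) up to an error 2 sqrt(nm) + 4n/(m+2) = O(n^(3/4)). *)

Require Import Defs.
From mathcomp Require Import all_boot all_order all_algebra.
From mathcomp Require Import all_classical all_reals all_analysis.
From mathcomp Require Import lra zify.

Set Implicit Arguments.
Unset Strict Implicit.
Unset Printing Implicit Defensive.

Import Order.TTheory GRing.Theory Num.Theory.
Import numFieldNormedType.Exports.
Local Open Scope classical_set_scope.
Local Open Scope ring_scope.

(** * Sizes of spheres and normalised mass of shells *)

Lemma hamming_weight_le n (x : cube n) : (hamming_weight x <= n)%N.
Proof. by rewrite -[X in (_ <= X)%N]card_ord max_card. Qed.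

Lemma card_hamming_sphere n k :
  #|[set x : cube n | hamming_weight x == k]%SET| = 'C(n, k).
Proof.
pose supp (x : cube n) : {set 'I_n} := [set i | tnth x i]%SET.
have supp_inj : injective supp.
  move=> x y /setP e; apply: eq_from_tnth => i.
  by have := e i; rewrite !inE.
rewrite -[X in 'C(X, _)]card_ord -card_draws -(card_imset _ supp_inj).
apply: eq_card => A; rewrite [RHS]inE; apply/imsetP/idP => [[x + ->]|Ak].
  by rewrite inE.
have sA : supp [tuple i \in A | i < n] = A.
  by apply/setP => i; rewrite inE tnth_mktuple.
by exists [tuple i \in A | i < n]; rewrite // inE /hamming_weight -/(supp _) sA.
Qed.

(** Each sphere of radius [k] has ['C(n, k)] points and so contributes exactly 1; [b <= n.+1] keeps
    these binomials nonzero. *)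
Lemma sum_hamming_shell (R : realType) n a b : (b <= n.+1)%N ->
  \sum_(x : cube n | (a <= hamming_weight x < b)%N)
    ('C(n, hamming_weight x)%:R : R)^-1 = (b - a)%:R.
Proof.
move=> bn.
rewrite (partition_big (fun x => inord (hamming_weight x) : 'I_n.+1)
  (fun k : 'I_n.+1 => (a <= k < b)%N)) /=; last first.
  by move=> x; rewrite inordK // ltnS hamming_weight_le.
have wE (x : cube n) (k : 'I_n.+1) :
    (inord (hamming_weight x) == k) = (hamming_weight x == k).
  by rewrite -val_eqE /= inordK // ltnS hamming_weight_le.
under eq_bigr => k abk.
  rewrite (eq_bigl (fun x => x \in [set x : cube n | hamming_weight x == k]%SET));
    last first.
    move=> x /=; rewrite wE inE.
    by case: (hamming_weight x =P k) => [->|]; rewrite ?andbF ?abk.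
  rewrite (eq_bigr (fun=> ('C(n, k)%:R : R)^-1)); last first.
    by move=> x; rewrite inE => /eqP ->.
  rewrite sumr_const card_hamming_sphere -(mulr_natr (_^-1)) mulVf; last first.
    by rewrite pnatr_eq0 -lt0n bin_gt0 -ltnS.
  over.
rewrite -(big_mkord (fun k => (a <= k < b)%N) (fun=> 1 : R)).
rewrite -(big_nat_widen 0 b n.+1 (fun k => (a <= k)%N)) //.
rewrite -(big_nat_widenl a 0 b predT) // big_const_nat.
by rewrite iter_addr_0.
Qed.

(** * Neighbours in the cube as coordinate flips *)

Definition flip n (i : 'I_n) (x : cube n) : cube n :=
  [tuple tnth x j (+) (j == i) | j < n].

Lemma adjacent_flip n (i : 'I_n) (x : cube n) : Defs.adjacent x (flip i x).
Proof.
rewrite /Defs.adjacent /hamming_distance.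
rewrite (_ : [set _ | _]%SET = [set i]%SET) ?cards1 //.
apply/setP => j; rewrite !inE tnth_mktuple.
by case: (tnth x j); case: (j == i).
Qed.

Lemma flip_inj n (x : cube n) : injective (fun i => flip i x).
Proof.
move=> i j /(congr1 (fun y => tnth y i)); rewrite !tnth_mktuple eqxx => /addbI.
by case: eqP.
Qed.

Lemma hamming_weight_flip n (i : 'I_n) (x : cube n) :
  hamming_weight (flip i x) =
  if tnth x i then (hamming_weight x).-1 else (hamming_weight x).+1.
Proof.
rewrite /hamming_weight; case: ifPn => xi.
  rewrite (cardsD1 i [set j | tnth x j]%SET) inE xi add1n /=.
  apply: eq_card => j; rewrite !inE tnth_mktuple.
  by case: eqVneq => [->|]; rewrite ?xi ?addbF.
have -> : #|[set j | tnth x j]%SET|.+1 = #|i |: [set j | tnth x j]%SET|.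
  by rewrite cardsU1 inE xi.
apply: eq_card => j; rewrite !inE tnth_mktuple.
by case: eqVneq => [->|]; rewrite ?(negbTE xi) ?addbF.
Qed.

(** Flipping one of the [n - k] zeros raises the weight to [k.+1], flipping one of the [k] ones
    lowers it to [k.-1]. As [g] is nonnegative, the sum over these distinct neighbours is a lower
    bound. For [k = 0] the truncated predecessor has coefficient 0. *)
Lemma adj_radial_ge (R : realType) n (g : nat -> R) (x : cube n) :
    (forall k, 0 <= g k) -> let k := hamming_weight x in
  (n - k)%:R * g k.+1 + k%:R * g k.-1 <=
  adj [ffun y : cube n => g (hamming_weight y)] x.
Proof.
move=> g0; cbv zeta; set k := hamming_weight x; rewrite ffunE.
rewrite [leRHS](bigID (mem [set flip i x | i in 'I_n]%SET)) /=.
apply: ler_wpDr; first by apply: sumr_ge0 => y _; rewrite ffunE.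
rewrite (eq_bigl (fun y => y \in [set flip i x | i in 'I_n]%SET)); last first.
  move=> y /=; case: imsetP; rewrite ?andbF // => -[i _ ->].
  by rewrite adjacent_flip.
rewrite big_imset /=; last by move=> i j _ _; apply: flip_inj.
rewrite (bigID (fun i => tnth x i)) /= addrC.
rewrite (eq_bigr (fun=> g k.+1)); last first.
  by move=> i /negbTE xi; rewrite ffunE hamming_weight_flip xi.
rewrite [X in _ <= _ + X](eq_bigr (fun=> g k.-1)); last first.
  by move=> i xi; rewrite ffunE hamming_weight_flip xi.
rewrite !sumr_const !mulr_natl.
have -> : #|[pred i | tnth x i]| = k.
  by apply: eq_card => i; rewrite !inE.
have -> // : #|[pred i | ~~ tnth x i]| = (n - k)%N.
have := cardsC [set i | tnth x i]%SET; rewrite card_ord => nE.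
rewrite -[n in RHS]nE /k addKn.
by apply: eq_card => i; rewrite !inE.
Qed.

Lemma rayleighE (R : realType) n (f : {ffun cube n -> R}) :
  rayleigh f = (\sum_x adj f x * f x) / \sum_x f x * f x.
Proof.
by rewrite /rayleigh /inner -mulf_div divff ?mul1r //
  invr_eq0 expf_neq0 // pnatr_eq0.
Qed.

Lemma rayleigh_le_lambda (R : realType) n (B : {set cube n})
    (f : {ffun cube n -> R}) :
  f != 0 -> support f \subset B -> rayleigh f <= lambda R B.
Proof.
move=> f0 fB.
have B0 : B != finset.set0.
  apply: contraNneq f0 => B0; apply/eqP/ffunP => x; rewrite ffunE.
  apply/eqP/negPn/negP => fx; have := fintype.subsetP fB x.
  by rewrite B0 !inE => /(_ fx).
by have [_] := lambda_is_max R B0; apply; exists f.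
Qed.

(** * Rayleigh quotient of the shell function *)

Section Shell.
Context (R : realType) (n : nat).

(* The reciprocal square root of the size of the sphere of radius k, so that
   a radial function with these values has the same mass on every sphere. *)
Let s k : R := Num.sqrt ('C(n, k)%:R)^-1.

Let s_ge0 k : 0 <= s k.
Proof. exact: sqrtr_ge0. Qed.

(** This is the square root of the identity [(k+1) C(n,k+1) = (n-k) C(n,k)]. *)
Let sS k : (k < n)%N ->
  s k.+1 * Num.sqrt (n - k)%:R = s k * Num.sqrt k.+1%:R.
Proof.
move=> kn; rewrite /s -!sqrtrM ?invr_ge0 ?ler0n //; congr Num.sqrt.
apply/eqP; rewrite mulrC [X in _ == X]mulrC.
rewrite eqr_div ?pnatr_eq0 -?lt0n ?bin_gt0 // 1?ltnW //.
by rewrite -!natrM -mul_bin_left mulnC.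
Qed.

Let sqrt_natK k : Num.sqrt k%:R * Num.sqrt k%:R = k%:R :> R.
Proof. by rewrite -expr2 sqr_sqrtr ?ler0n. Qed.

(** Here and in [s_down], [sS] trades one square root for the other, so going up from level [k] and
    coming down from [k.+1] give the same factor. *)
Let s_up k : (k < n)%N ->
  (n - k)%:R * s k.+1 = s k * (Num.sqrt (n - k)%:R * Num.sqrt k.+1%:R).
Proof.
move=> kn; rewrite -[in LHS]sqrt_natK -mulrA [_ * s k.+1]mulrC sS //.
by rewrite mulrCA.
Qed.

Let s_down k : (k < n)%N ->
  k.+1%:R * s k = s k.+1 * (Num.sqrt (n - k)%:R * Num.sqrt k.+1%:R).
Proof. by move=> kn; rewrite mulrA sS // -mulrA sqrt_natK mulrC. Qed.

Lemma lambda_ball_ge_shell r m : (m < r <= n)%N ->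
  m%:R / m.+2%:R * (2 * Num.sqrt ((n - r)%:R * (r - m)%:R)) <=
  lambda R (hamming_ball n r).
Proof.
move=> /andP[mr rn].
pose g k := if (r - m.+1 <= k < r.+1)%N then s k else 0.
have g0 k : 0 <= g k by rewrite /g; case: ifP.
pose f := [ffun x : cube n => g (hamming_weight x)].
have f2 : \sum_x f x * f x = m.+2%:R.
  rewrite -[m.+2](_ : r.+1 - (r - m.+1) = _)%N; last by lia.
  rewrite -(@sum_hamming_shell R n) ?ltnS // [RHS]big_mkcond.
  apply: eq_bigr => x _; rewrite ffunE /g; case: ifP; rewrite ?mulr0 // => _.
  by rewrite -expr2 sqr_sqrtr // invr_ge0 ler0n.
have f0 : f != 0.
  apply: contra_eq_neq f2 => ->; rewrite big1 ?(eq_sym 0) ?pnatr_eq0 // => x _.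
  by rewrite ffunE mulr0.
have fB : support f \subset hamming_ball n r.
  apply/fintype.subsetP => x; rewrite !inE ffunE /g.
  by case: ifP => [/andP[_]|]; rewrite ?eqxx.
apply: le_trans (rayleigh_le_lambda f0 fB).
rewrite rayleighE f2 mulrAC ler_wpM2r ?invr_ge0 ?ler0n //.
set c := 2 * _.
(* [m] counts the levels [r - m <= k < r], those whose two neighbouring levels both lie in the
   shell; at all other points the summand is only nonnegative. *)
rewrite -[m in m%:R](_ : r - (r - m) = _)%N; last by lia.
rewrite -(@sum_hamming_shell R n (r - m)) ?leqW //.
rewrite big_mkcond mulr_suml.
apply: ler_sum => x _.
have af := adj_radial_ge x g0.
have adj0 : 0 <= adj f x.
  by apply: le_trans af; rewrite addr_ge0 // mulr_ge0 ?ler0n.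
case: ifP => [|_]; last by rewrite mul0r mulr_ge0 // ffunE.
set k := hamming_weight x in af * => /andP[ak kr].
have fx : f x = s k by rewrite ffunE -/k /g ifT //; lia.
have -> : ('C(n, k)%:R : R)^-1 = s k * s k.
  by rewrite -expr2 sqr_sqrtr // invr_ge0 ler0n.
rewrite fx mulrAC ler_wpM2r // mulrC; apply: le_trans af.
(* Since [m < r], an interior level is positive; [s_down] is applied at its predecessor. *)
have [j kj] : exists j, k = j.+1 by exists k.-1; lia.
rewrite /g !ifT /=; [|lia..].
rewrite s_up; last by lia.
rewrite kj /= s_down -?kj; last by lia.
rewrite -mulrDr mulrC ler_wpM2l // /c mulr_natl mulr2n.
(* Both [(n-k)(k+1)] and [(n-j)(j+1)] are at least [(n-r)(r-m)], because [r - m <= k < r]. *)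
by rewrite -!sqrtrM ?ler0n // lerD // ler_wsqrtr // ler_pM ?ler0n // ler_nat; lia.
Qed.

(** The indicator of the origin is a nonnegative function supported in every ball. This covers radii
    too small for the shell bound. *)
Lemma lambda_ball_ge0 r : 0 <= lambda R (hamming_ball n r).
Proof.
pose g (k : nat) : R := (k == 0%N)%:R.
pose f := [ffun x : cube n => g (hamming_weight x)].
have g0 k : 0 <= g k by rewrite ler0n.
have f0 : f != 0.
  apply/eqP => /ffunP/(_ [tuple false | i < n]); rewrite !ffunE /g.
  rewrite (_ : hamming_weight _ = 0%N) ?eqxx; first by apply/eqP; rewrite oner_eq0.
  by apply: eq_card0 => i; rewrite !inE tnth_mktuple.
have fB : support f \subset hamming_ball n r.
  apply/fintype.subsetP => x; rewrite !inE ffunE /g.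
  by case: (_ =P 0%N) => [|_]; rewrite ?eqxx // => -[->].
apply: le_trans (rayleigh_le_lambda f0 fB).
rewrite rayleighE divr_ge0 // sumr_ge0 // => x _; rewrite ?ffunE ?mulr_ge0 //.
by rewrite sumr_ge0 // => y _; rewrite ffunE.
Qed.

End Shell.

(** * Error terms and the choice of [m] *)

Lemma sqrtD_le (R : rcfType) (a b : R) : 0 <= a -> 0 <= b ->
  Num.sqrt (a + b) <= Num.sqrt a + Num.sqrt b.
Proof.
move=> a0 b0; rewrite -ler_sqr ?nnegrE ?addr_ge0 ?sqrtr_ge0 //.
rewrite sqrrD !sqr_sqrtr ?addr_ge0 // addrAC lerDl.
by rewrite mulrn_wge0 // mulr_ge0 ?sqrtr_ge0.
Qed.

Lemma lambda_ball_ge (R : realType) n r m : (r <= n)%N ->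
  2 * Num.sqrt (r%:R * (n%:R - r%:R)) -
    (2 * Num.sqrt (n%:R * m%:R) + 4 * n%:R / m.+2%:R) <=
  lambda R (hamming_ball n r).
Proof.
move=> rn; rewrite -natrB //.
have q0 : 0 <= 4 * n%:R / m.+2%:R :> R by rewrite divr_ge0 ?mulr_ge0 ?ler0n.
have [rm|mr] := leqP r m.
  apply: le_trans (lambda_ball_ge0 R n r).
  suff sq_le : Num.sqrt (r%:R * (n - r)%:R) <= Num.sqrt (n%:R * m%:R) :> R.
    move: q0 sq_le; set q := 4 * _ / _; set a := Num.sqrt _; set b := Num.sqrt _.
    by move=> *; lra.
  by rewrite ler_wsqrtr // -!natrM ler_nat mulnC leq_mul ?leq_subr.
apply: le_trans (lambda_ball_ge_shell R (_ : (m < r <= n)%N)); last by rewrite mr.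
set c := Num.sqrt (_ * (r - m)%:R).
have c_le : c <= n%:R.
  rewrite -[leRHS]ger0_norm ?ler0n // -sqrtr_sqr ler_wsqrtr // expr2.
  by rewrite -!natrM ler_nat leq_mul ?leq_subr // (leq_trans (leq_subr _ _)).
(* Split [r(n-r) = (r-m)(n-r) + m(n-r)] and bound the last term by [nm]. *)
have sq_le : Num.sqrt (r%:R * (n - r)%:R) <= c + Num.sqrt (n%:R * m%:R).
  apply: le_trans (sqrtD_le _ _); rewrite ?mulr_ge0 ?ler0n //.
  rewrite ler_wsqrtr // -!natrM -natrD ler_nat.
  rewrite -[X in (X * _ <= _)%N](subnK (ltnW mr)) mulnDl [X in (X + _ <= _)%N]mulnC.
  by rewrite leq_add2l mulnC leq_mul ?leq_subr.
have -> : m%:R / m.+2%:R = 1 - 2 / m.+2%:R :> R.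
  rewrite [X in X / _ = _](_ : m%:R = m.+2%:R - 2).
    by rewrite mulrBl divff // pnatr_eq0.
  by rewrite -addn2 natrD addrK.
have : c / m.+2%:R <= n%:R / m.+2%:R by rewrite ler_wpM2r // invr_ge0 ler0n.
move: sq_le; set a := Num.sqrt _; set b := Num.sqrt (_ * m%:R); set M := m.+2%:R^-1.
by move=> *; lra.
Qed.

Theorem lemma1p4 (R : realType) :
  exists eps : nat -> R,
    (forall n : nat, 0 <= eps n) /\
    (eps n @[n --> \oo] --> (0 : R)) /\
    (forall n r : nat, (1 <= n)%N -> (r <= n)%N ->
      lambda R (hamming_ball n r) >=
        2 * Num.sqrt (r%:R * (n%:R - r%:R)) - eps n * n%:R).
Proof.
(* With [m] the integer part of the square root of [n], the two errors divided by [n] are at most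
   [2 n^(-1/4)] and [4 n^(-1/2)]. *)
pose t n : R := Num.sqrt (n%:R^-1).
exists (fun n => 2 * Num.sqrt (t n) + 4 * t n); split; [|split].
- by move=> n; rewrite addr_ge0 // mulr_ge0 ?sqrtr_ge0.
- have inv0 : (n%:R^-1 : R) @[n --> \oo] --> (0 : R).
    by rewrite -cvg_shiftS; exact: cvg_harmonic.
  have sqrt0 (u : nat -> R) :
      u n @[n --> \oo] --> (0 : R) -> Num.sqrt (u n) @[n --> \oo] --> (0 : R).
    move=> u0; rewrite -[X in _ --> X]sqrtr0.
    by apply: (continuous_cvg _ _ u0); exact: sqrt_continuous.
  have t0 := sqrt0 _ inv0.
  rewrite (_ : 0 = 2 * 0 + 4 * 0 :> R); last by rewrite !mulr0 addr0.
  by apply: cvgD; apply: cvgMr => //; exact: sqrt0.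
- move=> n r n1 rn.
  pose m := Num.truncn (Num.sqrt n%:R : R).
  apply: le_trans (lambda_ball_ge R m rn); rewrite /= lerD2l lerN2 [leRHS]mulrDl.
  have n0 : 0 < n%:R :> R by rewrite ltr0n.
  have s0 : 0 < Num.sqrt n%:R :> R by rewrite sqrtr_gt0.
  have tE : t n * n%:R = Num.sqrt n%:R.
    rewrite /t sqrtrV ?ler0n // -[X in _ * X]sqr_sqrtr ?ler0n //.
    by rewrite expr2 mulKf ?gt_eqF.
  have m_le : m%:R <= Num.sqrt n%:R :> R by rewrite truncn_le ltW.
  have m_gt : Num.sqrt n%:R < m.+1%:R :> R by exact: truncnS_gt.
  (* The first error uses [m <= sqrt n], the second [sqrt n < m + 2]; both rest on [tE]. *)
  apply: lerD; rewrite -!mulrA ler_wpM2l //.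
    rewrite -[X in _ <= _ * X]ger0_norm ?ler0n // -sqrtr_sqr -sqrtrM ?sqrtr_ge0 //.
    by rewrite ler_wsqrtr // expr2 mulrA tE mulrC ler_wpM2r ?ler0n.
  rewrite tE ler_pdivrMr ?ltr0n // -[leLHS]sqr_sqrtr ?ler0n // expr2.
  by rewrite ler_wpM2l ?ltW // (lt_trans m_gt) // ltr_nat.
Qed.
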